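(* Let $m$ be a positive integer and let $n,x,y$ be rational integers satisfying $n\ge 3$, $\max\{|x|,|y|\}\ge 2$ and $\Phi_n(x,y)=m$. Then $$\varphi(n)\le \frac{2}{\log 3}\log m \quad\text{and}\quad \max\{|x|,|y|\}\le \frac{2}{\sqrt 3}\, m^{1/\varphi(n)}.$$ In particular, there is no such solution when $m\in\{1,2\}$.
   Context: For $n\ge 1$, $\phi_n(X)\in\mathbb Z[X]$ denotes the $n$-th cyclotomic polynomial (degree $\varphi(n)$, $\varphi$ Euler's totient function), and the cyclotomic binary form is $\Phi_n(X,Y)=Y^{\varphi(n)}\phi_n(X/Y)$. *)

(* Defs.v *)
From mathcomp Require Import all_boot all_order all_algebra all_field.
Set Implicit Arguments. Unset Strict Implicit. Unset Printing Implicit Defensive.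
Import GRing.Theory.

(* Cyclotomic binary form  Phi_n(X,Y) = Y^{phi(n)} phi_n(X/Y)
   = \sum_i c_i X^i Y^{phi(n) - i}, where c_i are the coefficients of 'Phi_n
   (deg 'Phi_n = totient n). *)
Definition cycloBin (n : nat) (x y : int) : int :=
  (\sum_(i < (totient n).+1) ('Phi_n)`_i * x ^+ i * y ^+ (totient n - i))%R.

(* Main.v *)
(** The whole theorem follows from [Phi_n(x,y)^2 >= (3/4 max(x^2,y^2))^phi(n)]
    for [n >= 3]: taking logarithms and using [max >= 2] gives both bounds, and
    [m^2 >= 3^phi(n) >= 9] excludes [m <= 2].

    The inequality is proved at rational points by strong induction on [n].
    If [p^2 | n], then [phi_n(X) = phi_(n/p)(X^p)]; if [n = 2m] with [m] odd,
    then [phi_n(X) = phi_m(-X)].  Otherwise let [p] be the largest prime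
    factor of the odd squarefree [n = pm].  For [p >= 7] and [m > 1], use
    [phi_m(X^p) = phi_n(X) phi_m(X)] and the trivial bound
    [|phi_m(t)| <= (1 + |t|)^phi(m)]; the loss is harmless because
    [(3/4)^6 <= 3/16].  There remain the primes, [4] and [15]. *)
Require Import Defs.
From mathcomp Require Import all_boot all_order all_algebra all_field.
From mathcomp Require Import zify ring lra.
Set Implicit Arguments. Unset Strict Implicit. Unset Printing Implicit Defensive.
Import Order.TTheory GRing.Theory Num.Theory.

(** * Identities between cyclotomic polynomials *)

Section CyclotomicIdentities.
Local Open Scope ring_scope.

(** A multiplicative substitute for Möbius inversion: in the identity at [n], the factors at proper
    divisors agree by strong induction and cancel, being nonzero in an integral domain. *)
Lemma prod_divisors_inj (R : idomainType) (f g : nat -> R) n :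
    (0 < n)%N -> (forall d, f d != 0) ->
    (forall m, (m %| n)%N ->
       \prod_(d <- divisors m) f d = \prod_(d <- divisors m) g d) ->
  f n = g n.
Proof.
elim/ltn_ind: n => n IHn n_gt0 nz_f eq_fg.
have n_dvd : n \in divisors n by rewrite -dvdn_divisors.
have := eq_fg n (dvdnn n); rewrite !(big_rem n n_dvd) /=.
suff -> : \prod_(d <- rem n (divisors n)) g d
          = \prod_(d <- rem n (divisors n)) f d.
  apply: mulIf; elim/big_ind: _ => //; first exact: oner_neq0.
  by move=> a b; apply: mulf_neq0.
apply: eq_big_seq => d.
rewrite (mem_rem_uniq _ (divisors_uniq n)) inE -dvdn_divisors //.
case/andP=> d_neq_n d_dvd; apply/esym/IHn => //.
- by rewrite ltn_neqAle d_neq_n dvdn_leq.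
- exact: dvdn_gt0 d_dvd.
- by move=> m /dvdn_trans/(_ d_dvd)/eq_fg.
Qed.

(** A divisor of [p * m] that is a multiple of [p] is [p] times a divisor of [m]; any other is
    coprime to [p], hence divides [m] by Gauss's lemma. *)
Lemma prod_divisors_primeM (R : comNzRingType) (F : nat -> R) p m :
    prime p -> (0 < m)%N ->
  \prod_(d <- divisors (p * m)) F d
    = \prod_(d <- divisors m) F (p * d)%N
      * \prod_(d <- divisors m | ~~ (p %| d)%N) F d.
Proof.
move=> p_pr m_gt0; have p_gt0 := prime_gt0 p_pr.
have pm_gt0 : (0 < p * m)%N by rewrite muln_gt0 p_gt0.
rewrite (bigID (fun d => p %| d)%N) /=; congr (_ * _).
  rewrite -big_filter -(big_map (muln p) xpredT F); apply: perm_big.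
  apply: uniq_perm.
  - by rewrite filter_uniq ?divisors_uniq.
  - rewrite map_inj_uniq ?divisors_uniq // => a b /eqP.
    by rewrite eqn_pmul2l // => /eqP.
  move=> d; rewrite mem_filter -dvdn_divisors //; apply/andP/mapP.
    case=> /dvdnP[k ->]; rewrite mulnC dvdn_pmul2l // => k_m.
    by exists k; rewrite // -dvdn_divisors.
  case=> k; rewrite -dvdn_divisors // => k_m ->.
  by rewrite dvdn_mulr // dvdn_pmul2l.
rewrite -big_filter -[RHS]big_filter; apply: perm_big; apply: uniq_perm.
- by rewrite filter_uniq ?divisors_uniq.
- by rewrite filter_uniq ?divisors_uniq.
move=> d; rewrite !mem_filter -!dvdn_divisors //.
have [//|p'd /=] := boolP (p %| d)%N.
by rewrite Gauss_dvdr // coprime_sym prime_coprime.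
Qed.

Lemma Cyclotomic_neq0 n : 'Phi_n != 0.
Proof. exact/monic_neq0/Cyclotomic_monic. Qed.

(** Multiplied over the divisors of any [k] dividing [m], both sides give X^(pk) - 1, so
    [prod_divisors_inj] applies. *)
Lemma comp_Cyclotomic_Xp p m : prime p -> (0 < m)%N ->
  'Phi_m \Po 'X^p = 'Phi_(p * m) * (if (p %| m)%N then 1 else 'Phi_m).
Proof.
move=> p_pr m_gt0; have p_gt0 := prime_gt0 p_pr.
pose f d := 'Phi_d \Po 'X^p.
pose g d := 'Phi_(p * d) * (if (p %| d)%N then 1 else 'Phi_d).
apply: (@prod_divisors_inj _ f g) => // [d | k k_dvd].
  by rewrite comp_poly_eq0 ?Cyclotomic_neq0 // size_polyXn.
have k_gt0 := dvdn_gt0 m_gt0 k_dvd.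
rewrite /g big_split /=.
under [X in _ * X]eq_bigr => d _ do rewrite -if_neg.
rewrite -big_mkcond -(prod_divisors_primeM (fun d => 'Phi_d)) //.
rewrite prod_Cyclotomic ?muln_gt0 ?p_gt0 // -(rmorph_prod (comp_poly 'X^p)).
by rewrite prod_Cyclotomic // rmorphB rmorph1 /= comp_Xn_poly exprM.
Qed.

Lemma Cyclotomic1 : 'Phi_1 = 'X - 1.
Proof. by rewrite -[RHS](prod_Cyclotomic (n := 1)) // big_seq1. Qed.

Lemma Cyclotomic2M m : odd m -> (1 < m)%N -> 'Phi_(2 * m) = 'Phi_m \Po - 'X.
Proof.
move=> odd_m m_gt1.
pose f d := 'Phi_(2 * d).
(* The sign corrects [d = 1], where phi_2(X) = X + 1 = -phi_1(-X). *)
pose g d := (if d == 1 then -1 else 1) * ('Phi_d \Po - 'X).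
have -> : 'Phi_m \Po - 'X = g m.
  by rewrite /g gtn_eqF // mul1r.
apply: (@prod_divisors_inj _ f g) => // [|d|k k_dvd]; first exact: ltnW.
  exact: Cyclotomic_neq0.
have odd_k := dvdn_odd k_dvd odd_m; have k_gt0 := odd_gt0 odd_k.
(* The factor X^k - 1 supplies the odd divisors of 2k, completing the product of the phi_(2d) to
   X^(2k) - 1; the other side is (X^k + 1)(X^k - 1). *)
have: 'X^k - 1 != 0 :> {poly int}.
  by rewrite -size_poly_eq0 size_XnsubC.
move/mulIf; apply.
rewrite -{1}(prod_Cyclotomic k_gt0).
have -> : \prod_(d <- divisors k) 'Phi_d
          = \prod_(d <- divisors k | ~~ (2 %| d)%N) 'Phi_d.
  rewrite big_seq_cond [RHS]big_seq_cond; apply: eq_bigl => d.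
  rewrite !andbT -dvdn_divisors // dvdn2 negbK.
  by case: (boolP (d %| k)%N) => //= /dvdn_odd ->.
rewrite -(prod_divisors_primeM (fun d => 'Phi_d)) // prod_Cyclotomic; last lia.
rewrite /g big_split /= -(rmorph_prod (comp_poly (- 'X))) prod_Cyclotomic //.
have -> : \prod_(d <- divisors k) (if d == 1 then -1 else 1) = -1 :> {poly int}.
  by rewrite -big_mkcond -big_filter filter_pred1_uniq ?divisors_uniq ?divisor1
             ?big_seq1.
rewrite rmorphB rmorph1 /= comp_Xn_poly exprNn -signr_odd odd_k mulnC exprM.
by rewrite expr1; ring.
Qed.

(** Compare degrees in phi_m(X^p) = phi_(pm)(X). *)
Lemma totient_prime_dvdM p m : prime p -> (0 < m)%N -> (p %| m)%N ->
  totient (p * m) = (p * totient m)%N.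
Proof.
move=> p_pr m_gt0 p_m.
have := comp_Cyclotomic_Xp p_pr m_gt0; rewrite p_m mulr1.
move/(congr1 (fun q : {poly int} => (size q).-1)).
by rewrite size_comp_poly !size_Cyclotomic size_polyXn /= mulnC => <-.
Qed.
End CyclotomicIdentities.

(** * Lower bounds for cyclotomic polynomials at rational points *)

Section CyclotomicBounds.
Local Open Scope ring_scope.
Implicit Types (t : rat) (m n p : nat).

Lemma expr_homo (x y : rat) k : 0 <= x -> x <= y -> x ^+ k <= y ^+ k.
Proof.
by move=> x_ge0 le_xy; rewrite lerXn2r ?nnegrE // (le_trans x_ge0).
Qed.

(** Used with [k = p - 1]; this is where [p >= 7] enters, since (3/4)^4 > 3/16. *)
Lemma expr_three_quarters_le (R : realFieldType) k :
  (6 <= k)%N -> (3 / 4) ^+ k <= 3 / 16 :> R.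
Proof.
move=> k_ge6; apply: (@le_trans _ _ ((3 / 4) ^+ 6)); last by lra.
by apply: ler_wiXn2l => //; lra.
Qed.

Definition cycloEval n t : rat := (map_poly intr 'Phi_n).[t].

(* [max1 (x / y)] is [max (|x|, |y|) / |y|], so that bounds in terms of [max1]
   are the dehomogenized form of bounds in terms of [max (|x|, |y|)]. *)
Definition max1 t : rat := Num.max 1 `|t|.

Lemma max1_ge1 t : 1 <= max1 t.
Proof. by rewrite le_max lexx. Qed.

Lemma max1_gt0 t : 0 < max1 t.
Proof. exact: lt_le_trans ltr01 (max1_ge1 t). Qed.

Lemma max1X_ge0 t k : 0 <= max1 t ^+ k.
Proof. by rewrite exprn_ge0 // ltW ?max1_gt0. Qed.

Lemma bound_base_gt0 t : 0 < 3 / 4 * max1 t ^+ 2.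
Proof. by have := exprn_gt0 2 (max1_gt0 t); lra. Qed.

Lemma bound_base_ge0 t : 0 <= 3 / 4 * max1 t ^+ 2.
Proof. exact: ltW (bound_base_gt0 t). Qed.

Lemma max1_ge_norm t : `|t| <= max1 t.
Proof. by rewrite le_max lexx orbT. Qed.

Lemma max1X t k : max1 (t ^+ k) = max1 t ^+ k.
Proof.
rewrite /max1 normrX; case: (leP 1 `|t|) => [t_ge1 | /ltW t_le1].
  by apply/max_idPr; rewrite exprn_ege1.
by rewrite expr1n; apply/max_idPl; rewrite exprn_ile1.
Qed.

Lemma max1N t : max1 (- t) = max1 t.
Proof. by rewrite /max1 normrN. Qed.

Lemma cycloEvalXp p m t : prime p -> (0 < m)%N ->
  cycloEval m (t ^+ p)
    = cycloEval (p * m) t * (if (p %| m)%N then 1 else cycloEval m t).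
Proof.
move=> p_pr m_gt0; rewrite /cycloEval.
have -> : (map_poly intr 'Phi_m).[t ^+ p]
          = (map_poly intr ('Phi_m \Po 'X^p)).[t] :> rat.
  by rewrite map_comp_poly map_polyXn horner_comp hornerXn.
rewrite comp_Cyclotomic_Xp // rmorphM hornerM; congr (_ * _).
by case: ifP => // _; rewrite rmorph1 hornerE.
Qed.

Lemma cycloEval2M m t : odd m -> (1 < m)%N ->
  cycloEval (2 * m) t = cycloEval m (- t).
Proof.
move=> odd_m m_gt1; rewrite /cycloEval Cyclotomic2M // map_comp_poly.
by rewrite horner_comp rmorphN /= map_polyX !hornerE.
Qed.

Lemma cycloEval_prime p t : prime p -> cycloEval p t = \sum_(i < p) t ^+ i.
Proof.
move=> p_pr; rewrite /cycloEval; have -> : 'Phi_p = \sum_(i < p) 'X^i.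
  have nz : 'X - 1 != 0 :> {poly int} by rewrite -size_poly_eq0 size_XsubC.
  apply: (mulIf nz); rewrite [RHS]mulrC -subrX1.
  (* The case [m = 1] reads X^p - 1 = phi_p(X) (X - 1). *)
  have := comp_Cyclotomic_Xp p_pr (ltn0Sn 0).
  rewrite muln1 Cyclotomic1 rmorphB /= comp_polyX rmorph1 => ->.
  by rewrite ifN // dvdn1 neq_ltn prime_gt1 ?orbT.
rewrite rmorph_sum horner_sum; apply: eq_bigr => i _.
by rewrite /= map_polyXn hornerXn.
Qed.

(** Over [algC], each of the [totient n] linear factors t - z^k has modulus at most |t| + 1 <= 2
    max1 t. *)
Lemma norm_cycloEval_le n t : (0 < n)%N ->
  `|cycloEval n t| <= (2 * max1 t) ^+ totient n.
Proof.
move=> n_gt0; have [z prim_z] := C_prim_root_exists n_gt0.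
have z1 : `|z| = 1.
  by apply/eqP; rewrite -(pexpr_eq1 n_gt0) // -normrX prim_expr_order ?normr1.
rewrite -(ler_rat algC) ratr_norm.
have -> : ratr (cycloEval n t) = (cyclotomic z n).[ratr t] :> algC.
  rewrite -(Cintr_Cyclotomic prim_z) /cycloEval -horner_map -map_poly_comp /=.
  by congr (_.[_]); apply: eq_map_poly => k /=; rewrite ratr_int.
rewrite /cyclotomic horner_prod normr_prod.
have -> : totient n = #|[pred k : 'I_n | coprime k n]|.
  rewrite totient_count_coprime -big_mkcond big_mkord -sum1_card.
  by apply: eq_bigl => k; rewrite coprime_sym.
rewrite rmorphXn /= -prodr_const; apply: ler_prod => k _.
rewrite normr_ge0 hornerXsubC /= (le_trans (ler_normB _ _)) //.
rewrite normrX z1 expr1n -ratr_norm -[1](rmorph1 (@ratr algC)) -rmorphD ler_rat.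
by have := max1_ge1 t; have := max1_ge_norm t; lra.
Qed.

(* The bound [phi_n(t) >= (sqrt 3 / 2 * max1 t)^phi(n)], squared so as to stay
   in [rat]. *)
Definition cyclo_bounded n :=
  forall t, 0 < cycloEval n t
         /\ (3 / 4 * max1 t ^+ 2) ^+ totient n <= cycloEval n t ^+ 2.

(** The bound for [m] at t^p has base 3/4 max1(t)^(2p), which dominates (3/4 max1(t)^2)^p because
    (3/4)^p <= 3/4. *)
Lemma cyclo_bounded_dvdM p m : prime p -> (0 < m)%N -> (p %| m)%N ->
  cyclo_bounded m -> cyclo_bounded (p * m).
Proof.
move=> p_pr m_gt0 p_m bd_m t; have := bd_m (t ^+ p).
rewrite cycloEvalXp // p_m mulr1 => -[pos le]; split=> //.
apply: le_trans le; rewrite totient_prime_dvdM // max1X exprM.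
apply: expr_homo; first by rewrite exprn_ge0 ?bound_base_ge0.
rewrite exprMn -!exprM mulnC ler_wpM2r ?max1X_ge0 //.
rewrite -[leRHS]expr1; apply: ler_wiXn2l (prime_gt0 p_pr); lra.
Qed.

Lemma cyclo_bounded2M m : odd m -> (1 < m)%N ->
  cyclo_bounded m -> cyclo_bounded (2 * m).
Proof.
move=> odd_m m_gt1 bd_m t; rewrite cycloEval2M // -max1N.
by rewrite totient_coprime ?mul1n ?coprime2n //; apply: bd_m.
Qed.

(** The bound at t^p is divided by phi_m(t)^2 <= (4 max1(t)^2)^phi(m); positivity of the quotient
    follows from the bounds for [m] at t and at t^p. *)
Lemma cyclo_bounded_coprimeM p m :
    prime p -> (6 < p)%N -> (0 < m)%N -> ~~ (p %| m)%N ->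
  cyclo_bounded m -> cyclo_bounded (p * m).
Proof.
move=> p_pr p_gt6 m_gt0 p'm bd_m t.
have [pos le] := bd_m (t ^+ p); have [pos1 _] := bd_m t.
rewrite cycloEvalXp // (negPf p'm) pmulr_lgt0 // in pos le.
split=> //; have := norm_cycloEval_le t m_gt0.
rewrite (gtr0_norm pos1) => up.
have M_gt0 := max1_gt0 t.
have up2 : cycloEval m t ^+ 2 <= (4 * max1 t ^+ 2) ^+ totient m.
  apply: le_trans (expr_homo 2 (ltW pos1) up) _.
  by rewrite exprAC (_ : (2 * max1 t) ^+ 2 = 4 * max1 t ^+ 2) //; ring.
rewrite [leRHS]exprMn in le.
rewrite totient_coprime ?prime_coprime // totient_prime // exprM.
have c_gt0 : 0 < (4 * max1 t ^+ 2) ^+ totient m.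
  by rewrite exprn_gt0 // mulr_gt0 // exprn_gt0.
rewrite -(ler_pM2r c_gt0).
apply: le_trans (le_trans le (ler_wpM2l (sqr_ge0 _) up2)).
rewrite -exprMn; apply: expr_homo.
  apply: mulr_ge0; first exact: exprn_ge0 (bound_base_ge0 t).
  by apply: mulr_ge0 (max1X_ge0 t 2).
(* With x = max1(t)^2, comparing the bases of the exponent [totient m] leaves (3/4 x)^(p-1) * 4x <=
   3/4 x^p, that is (3/4)^(p-1) <= 3/16. *)
rewrite max1X exprAC; have : 0 < max1 t ^+ 2 by rewrite exprn_gt0.
move: (max1 t ^+ 2) => x x_gt0.
have [k k_ge6 ->] : exists2 k, (6 <= k)%N & p = k.+1.
  by exists p.-1; [rewrite -ltnS|]; rewrite prednK // prime_gt0.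
have small := expr_three_quarters_le rat k_ge6; rewrite [k.+1.-1]/=.
have y_gt0 : 0 < x ^+ k * x by rewrite mulr_gt0 ?exprn_gt0.
rewrite exprMn exprSr; move: (ler_wpM2r (ltW y_gt0) small).
by move: ((3 / 4) ^+ k) (x ^+ k) => c y; lra.
Qed.

Lemma cyclo_bounded_prime p : prime p -> (6 < p)%N -> cyclo_bounded p.
Proof.
move=> p_pr p_gt6 t; rewrite cycloEval_prime // totient_prime //.
set g := \sum_(i < p) t ^+ i.
have M_gt0 := max1_gt0 t.
(* Losing a factor 2 is harmless: after squaring it costs 1/4, while (3/4)^(p-1) <= 3/16. *)
suff g_ge : max1 t ^+ p.-1 / 2 <= g.
  have Mp_gt0 : 0 < max1 t ^+ p.-1 by rewrite exprn_gt0.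
  have g_gt0 : 0 < g by lra.
  split=> //; rewrite exprMn exprAC.
  have p1_ge6 : (6 <= p.-1)%N by rewrite -ltnS prednK // prime_gt0.
  have small := expr_three_quarters_le rat p1_ge6.
  apply: le_trans (ler_wpM2r (sqr_ge0 _) small) _.
  have := expr_homo 2 (divr_ge0 (ltW Mp_gt0) (ler0n _ 2)) g_ge.
  by have := sqr_ge0 (max1 t ^+ p.-1); rewrite expr_div_n; lra.
have gE : (t - 1) * g = t ^+ p - 1 by rewrite -subrX1.
have [t_ge0 | t_lt0] := leP 0 t.
  (* All terms of the sum are nonnegative, and those of index 0 and p - 1 already give the
     maximum. *)
  suff : max1 t ^+ p.-1 <= g.
    by have := exprn_gt0 p.-1 M_gt0; lra.
  rewrite -max1X /max1 ger0_norm ?exprn_ge0 // ge_max /g.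
  have p_gt0 := prime_gt0 p_pr.
  apply/andP; split.
    rewrite (bigD1 (Ordinal p_gt0)) //= expr0 lerDl.
    by rewrite sumr_ge0 // => i _; rewrite exprn_ge0.
  have p1 : (p.-1 < p)%N by rewrite prednK.
  rewrite (bigD1 (Ordinal p1)) //= lerDl.
  by rewrite sumr_ge0 // => i _; rewrite exprn_ge0.
(* For t < 0 and p odd, (1 + |t|) g = 1 + |t|^p, and 1 + |t| <= 2 max1 t. *)
have odd_p : odd p by case/even_prime: p_pr p_gt6 => ->.
have tpE : t ^+ p = - (`|t| ^+ p).
  by rewrite -normrX ler0_norm ?opprK // exprn_odd_le0 // ltW.
have g_lt0 : (1 + `|t|) * g = 1 + `|t| ^+ p.
  by move: gE; rewrite tpE (ltr0_norm t_lt0); lra.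
have s_ge0 := normr_ge0 t.
rewrite -(ler_pM2l (_ : 0 < 1 + `|t|)) ?g_lt0; last by lra.
rewrite /max1; case: (leP 1 `|t|) => [s_ge1 | /ltW s_le1].
  rewrite -[in leRHS](prednK (prime_gt0 p_pr)) exprS.
  have := exprn_ge0 p.-1 s_ge0; nra.
by rewrite expr1n; have := exprn_ge0 p s_ge0; lra.
Qed.

(** The source of the constant 3/4: the differences are exactly (t/2 + 1)^2 and (t + 1/2)^2, so
    equality occurs at t = -2 and t = -1/2. *)
Lemma cyclo_bounded3 : cyclo_bounded 3.
Proof.
move=> t; rewrite (@cycloEval_prime 3 t isT) (@totient_prime 3 isT).
rewrite !big_ord_recl big_ord0 /bump !addr0 expr0.
suff le : 3 / 4 * max1 t ^+ 2 <= 1 + (t ^+ 1 + t ^+ 2).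
  have : 0 < max1 t ^+ 2 by rewrite exprn_gt0 ?max1_gt0.
  split; first lra.
  by apply: expr_homo; lra.
rewrite /max1; case: (leP 1 `|t|) => _.
  by rewrite (real_normK (num_real t)); have := sqr_ge0 (t / 2 + 1); lra.
by rewrite expr1n; have := sqr_ge0 (t + 1 / 2); lra.
Qed.

Lemma cyclo_bounded5 : cyclo_bounded 5.
Proof.
move=> t; rewrite (@cycloEval_prime 5 t isT) (@totient_prime 5 isT).
rewrite !big_ord_recl big_ord0 /bump !addr0 expr0.
set g := 1 + _.
suff le : (3 / 4 * max1 t ^+ 2) ^+ 2 <= g.
  have : 0 < (3 / 4 * max1 t ^+ 2) ^+ 2.
    exact: exprn_gt0 (bound_base_gt0 t).
  split; first lra.
  by rewrite (exprM _ 2 2); apply: expr_homo; lra.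
rewrite /max1; case: (leP 1 `|t|) => _.
  rewrite (real_normK (num_real t)) /g.
  (* g - 9/16 t^4 = (t/2 + 1)^2 + 7/16 (t (t + 8/7))^2 + 5/28 t^2. *)
  have := sqr_ge0 (t / 2 + 1); have := sqr_ge0 (t * (t + 8 / 7)).
  by have := sqr_ge0 t; lra.
(* g - 9/16 = (t^2 + t/2)^2 + 3/4 (t + 2/3)^2 + 5/48. *)
rewrite expr1n /g; have := sqr_ge0 (t ^+ 2 + t / 2).
by have := sqr_ge0 (t + 2 / 3); lra.
Qed.

(* For [t >= 0], [phi_3(t^5) >= max1 t ^ 10] and [phi_3(t) <= 3 max1 t ^ 2];
   for [t < 0], [phi_3(t^5) >= 3/4 max1 t ^ 10] and [phi_3(t) <= max1 t ^ 2]. *)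
Lemma cyclo_bounded15 : cyclo_bounded 15.
Proof.
move=> t; have e3 s : cycloEval 3 s = 1 + s + s ^+ 2.
  by rewrite cycloEval_prime // !big_ord_recr big_ord0 /= add0r expr0.
have := @cycloEvalXp 5 3 t isT isT; rewrite /= -[(5 * 3)%N]/15%N => E.
have [pos3 _] := cyclo_bounded3 t.
have [pos35 _] := cyclo_bounded3 (t ^+ 5).
have M_gt0 := max1_gt0 t; have M_ge := max1_ge_norm t; have M1 := max1_ge1 t.
have pos : 0 < cycloEval 15 t by move: pos35; rewrite E pmulr_lgt0.
split; first exact: pos.
have -> : totient 15 = (4 * 2)%N by [].
rewrite exprM.
apply: expr_homo; first by rewrite exprn_ge0 ?bound_base_ge0.
have low : 3 / 4 * (max1 t ^+ 5) ^+ 2 <= cycloEval 3 (t ^+ 5).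
  have [_] := cyclo_bounded3 (t ^+ 5); have -> : totient 3 = 2 by [].
  by rewrite ler_sqr ?nnegrE ?bound_base_ge0 ?(ltW pos35) ?max1X.
rewrite -(ler_pM2r pos3) -E.
have [t_ge0 | t_lt0] := leP 0 t.
  have up : cycloEval 3 t <= 3 * max1 t ^+ 2.
    by rewrite e3; move: M_ge; rewrite ger0_norm //; nra.
  have {}low : max1 t ^+ 10 <= cycloEval 3 (t ^+ 5).
    rewrite e3 -max1X /max1 -exprM ger0_norm ?exprn_ge0 // ge_max.
    have := exprn_ge0 5 t_ge0; have := exprn_ge0 10 t_ge0.
    by move: (t ^+ 5) (t ^+ 10) => a b; lra.
  apply: le_trans low; apply: le_trans (ler_wpM2l _ up) _.
    by rewrite exprn_ge0 ?bound_base_ge0.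
  by have := max1X_ge0 t 10; lra.
have up : cycloEval 3 t <= max1 t ^+ 2.
  rewrite e3 /max1; case: (leP 1 `|t|); rewrite ltr0_norm // => t1; nra.
apply: le_trans low; apply: le_trans (ler_wpM2l _ up) _.
  by rewrite exprn_ge0 ?bound_base_ge0.
by have := max1X_ge0 t 10; lra.
Qed.

Lemma odd_prime_le6 p : prime p -> odd p -> (p <= 6)%N -> p = 3 \/ p = 5.
Proof. by case: p => [|[|[|[|[|[|[|p]]]]]]] //; [left | right]. Qed.

Lemma cyclo_boundedP n : (2 < n)%N -> cyclo_bounded n.
Proof.
elim/ltn_ind: n => n IHn n_gt2.
have n_gt0 : (0 < n)%N by apply: ltnW (ltnW n_gt2).
have [/existsP[[p _] /andP[/= p_pr]] | sqfree]
  := boolP [exists p : 'I_n, prime p && (p * p %| n)%N].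
  case/dvdnP=> k nE; have p_gt1 := prime_gt1 p_pr.
  have {nE} nE : n = (p * (p * k))%N by rewrite nE mulnC mulnA.
  have pk_gt0 : (0 < p * k)%N by lia.
  (* Induction applies to n/p = pk only above 2; otherwise n = 4, where phi_4(t) = phi_2(t^2) = 1 +
     t^2. *)
  have [pk_gt2 | pk_le2] := ltnP 2 (p * k).
    rewrite nE; apply: cyclo_bounded_dvdM => //; first exact: dvdn_mulr.
    by apply: IHn => //; rewrite nE; nia.
  have k_gt0 : (0 < k)%N by move: pk_gt0; rewrite muln_gt0 => /andP[].
  have p2 : p = 2 by nia.
  have k1 : k = 1 by rewrite p2 in pk_le2; lia.
  have -> : n = 4 by rewrite nE p2 k1.
  move=> t; have := @cycloEvalXp 2 2 t isT isT; rewrite /= mulr1 => <-.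
  rewrite (@cycloEval_prime 2 _ isT) !big_ord_recl big_ord0 addr0 expr0 expr1.
  have -> : totient 4 = 2 by [].
  have := sqr_ge0 t => t2; split; first lra.
  apply: expr_homo; first exact: bound_base_ge0.
  rewrite /max1; case: (leP 1 `|t|) => _; rewrite ?expr1n; last by lra.
  by rewrite (real_normK (num_real t)); lra.
have {}sqfree p : prime p -> ~~ (p * p %| n)%N.
  move=> p_pr; apply/negP => pp_n; move/existsPn: sqfree.
  have p_lt : (p < n)%N.
    by apply: leq_trans (dvdn_leq n_gt0 pp_n); have := prime_gt1 p_pr; nia.
  by move/(_ (Ordinal p_lt)); rewrite /= p_pr pp_n.
have [odd_n | even_n] := boolP (odd n); last first.
  have /dvdnP[m nE] : (2 %| n)%N by rewrite dvdn2.
  have odd_m : odd m.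
    by have := sqfree 2 isT; rewrite nE dvdn_pmul2r // dvdn2 negbK.
  rewrite nE mulnC; apply: cyclo_bounded2M => //; first lia.
  apply: IHn; first lia.
  by case: m odd_m nE n_gt2 => [|[|[|m]]] //= _ ->.
have [p [p_pr p_n p_max]] : exists p, [/\ prime p, (p %| n)%N
    & forall q, prime q -> (q %| n)%N -> (q <= p)%N].
  exists (max_pdiv n); split.
  - exact/max_pdiv_prime/ltnW.
  - exact: max_pdiv_dvd.
  by move=> q q_pr q_n; apply: max_pdiv_max; rewrite inE mem_primes q_pr n_gt0.
have odd_p := dvdn_odd p_n odd_n.
have /dvdnP[m nE] := p_n; rewrite mulnC in nE.
have m_gt0 : (0 < m)%N by move: n_gt0; rewrite nE muln_gt0 => /andP[].
have odd_m : odd m by move: odd_n; rewrite nE oddM => /andP[].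
have p'm : ~~ (p %| m)%N.
  apply/negP => /dvdnP[k mE].
  by have := sqfree p p_pr; rewrite nE mE mulnCA dvdn_mull.
have [m_gt1 | m_le1] := ltnP 1 m; last first.
  have m1 : m = 1 by apply/eqP; rewrite eqn_leq m_le1.
  have -> : n = p by rewrite nE m1 muln1.
  have [p_gt6 | p_le6] := ltnP 6 p; first exact: cyclo_bounded_prime.
  have [-> | ->] := odd_prime_le6 p_pr odd_p p_le6; first exact: cyclo_bounded3.
  exact: cyclo_bounded5.
have [p_gt6 | p_le6] := ltnP 6 p.
  rewrite nE; apply: cyclo_bounded_coprimeM => //; apply: IHn.
    by rewrite nE ltn_Pmull ?prime_gt1.
  by case: m m_gt1 odd_m {nE p'm m_gt0} => [|[|[|m]]].
(* With [p <= 5], a prime factor of [m] is odd and smaller than [p], which forces 3 and p = 5;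
   squarefreeness then gives m = 3. *)
have q35 q : prime q -> (q %| m)%N -> q = 3 /\ p = 5.
  move=> q_pr q_m; have q_n : (q %| n)%N by rewrite nE dvdn_mull.
  have q_le_p := p_max q q_pr q_n; have odd_q := dvdn_odd q_n odd_n.
  have := odd_prime_le6 q_pr odd_q (leq_trans q_le_p p_le6).
  have := odd_prime_le6 p_pr odd_p p_le6.
  have q_neq_p : q <> p by move=> qp; rewrite -qp q_m in p'm.
  by move=> [p3|p5] [q3|q5]; split; lia.
have [m3 p5] := q35 _ (pdiv_prime m_gt1) (pdiv_dvd m).
have /dvdnP[k mE] := pdiv_dvd m; rewrite m3 in mE.
have k1 : k = 1.
  apply/eqP; rewrite eqn_leq; apply/andP; split; last by lia.
  rewrite leqNgt; apply/negP => k_gt1.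
  have k_m : (pdiv k %| m)%N by rewrite mE dvdn_mulr ?pdiv_dvd.
  have [k3 _] := q35 _ (pdiv_prime k_gt1) k_m.
  have := sqfree 3 isT.
  by rewrite nE mE dvdn_mull // dvdn_pmul2r // -[3]k3 pdiv_dvd.
have -> : n = 15 by rewrite nE mE k1 p5.
exact: cyclo_bounded15.
Qed.
End CyclotomicBounds.

(** * From rational points to the binary form at integers *)

Section CyclotomicForm.
Local Open Scope ring_scope.
Implicit Types (n : nat) (x y : int).

(** The point at infinity, not covered by x/y: only the leading term survives, with coefficient 1
    and 0^0 = 1. *)
Lemma cycloBin0 n x : cycloBin n x 0 = x ^+ totient n.
Proof.
rewrite /cycloBin big_ord_recr /= big1 => [|i _].
  have := monicP (Cyclotomic_monic n); rewrite lead_coefE size_Cyclotomic /=.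
  by move=> ->; rewrite subnn expr0 mulr1 mul1r add0r.
by rewrite expr0n subn_eq0 leqNgt ltn_ord mulr0.
Qed.

Lemma cycloBinE n x y : y != 0 ->
  (cycloBin n x y)%:~R = y%:~R ^+ totient n * cycloEval n (x%:~R / y%:~R).
Proof.
move=> y_neq0; have yQ : y%:~R != 0 :> rat by rewrite intr_eq0.
rewrite /cycloEval (@horner_coef_wide _ (totient n).+1); last first.
  by rewrite -size_Cyclotomic size_poly.
rewrite /cycloBin rmorph_sum mulr_sumr; apply: eq_bigr => i _ /=.
rewrite coef_map /= !rmorphM !rmorphXn /= expr_div_n.
have i_le : (i <= totient n)%N by rewrite -ltnS.
have -> : y%:~R ^+ totient n = y%:~R ^+ (totient n - i) * y%:~R ^+ i :> rat.
  by rewrite -exprD subnK.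
have := expf_neq0 i yQ.
move: (y%:~R ^+ i) (y%:~R ^+ _) (x%:~R ^+ i) => a b c a_neq0; field.
exact: a_neq0.
Qed.

(** The rational bound at x/y is multiplied by y^(2 phi(n)); powers of 4 are cleared to stay in
    [nat]. *)
Lemma cycloBin_bound n x y : (2 < n)%N ->
  ((3 * maxn `|x| `|y| ^ 2) ^ totient n
     <= 4 ^ totient n * `|cycloBin n x y| ^ 2)%N.
Proof.
move=> n_gt2; set K := maxn _ _; set c := cycloBin n x y.
suff main : (3 / 4 * K%:R ^+ 2) ^+ totient n <= c%:~R ^+ 2 :> rat.
  rewrite -(ler_nat rat) natrM !natrX natrM natrX natr_absz intr_norm.
  rewrite (real_normK (num_real _)) [leRHS]mulrC -ler_pdivrMr ?exprn_gt0 //.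
  by rewrite -expr_div_n mulrAC.
have [y0 | y_neq0] := eqVneq y 0.
  have -> : K%:R ^+ 2 = x%:~R ^+ 2 :> rat.
    rewrite /K y0 absz0 maxn0 natr_absz intr_norm.
    exact: real_normK (num_real _).
  rewrite /c y0 cycloBin0 rmorphXn /= exprAC; apply: expr_homo.
    by have := sqr_ge0 (x%:~R : rat); lra.
  by have := sqr_ge0 (x%:~R : rat); lra.
have [_] := cyclo_boundedP n_gt2 (x%:~R / y%:~R).
have y2_ge0 : 0 <= (y%:~R ^+ totient n) ^+ 2 :> rat by apply: sqr_ge0.
move/(ler_wpM2l y2_ge0); rewrite -[leRHS]exprMn -cycloBinE // exprAC -exprMn.
suff -> : K%:R = `|y%:~R| * max1 (x%:~R / y%:~R) :> rat.
  by rewrite [(_ * max1 _) ^+ 2]exprMn (real_normK (num_real _)) mulrCA.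
rewrite /max1 maxr_pMr ?normr_ge0 // mulr1 -normrM.
rewrite mulrCA divff ?intr_eq0 // mulr1 -!intr_norm -!natr_absz.
by rewrite /K; case: (leqP `|x| `|y|) => [le_xy | /ltnW le_yx];
   [rewrite max_l | rewrite max_r]; rewrite ?ler_nat.
Qed.

(** [K >= 2] lets 4^f cancel, leaving 9 <= 3^f <= m^2. *)
Lemma gt2_of_form_bound f K m : (1 < f)%N -> (2 <= K)%N ->
  ((3 * K ^ 2) ^ f <= 4 ^ f * m ^ 2)%N -> (2 < m)%N.
Proof.
move=> f_gt1 K_ge2 bound.
have: (4 ^ f * 3 ^ f <= 4 ^ f * m ^ 2)%N.
  apply: leq_trans bound; rewrite -expnMn leq_exp2r ?(ltnW f_gt1) //.
  by rewrite mulnC leq_pmul2l // (@leq_sqr 2).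
rewrite leq_pmul2l ?expn_gt0 // => le.
by rewrite -leq_sqr (leq_trans _ le) // (@leq_exp2l 3 2).
Qed.
End CyclotomicForm.

(* Logarithms and the real bounds *)
From Stdlib Require Import Reals Lra.

Lemma ln_le (u v : R) : (0 < u)%R -> (u <= v)%R -> (ln u <= ln v)%R.
Proof.
move=> u_pos [lt_uv | ->]; last exact: Rle_refl.
exact/Rlt_le/ln_increasing.
Qed.

Lemma INR_expn a k : INR (expn a k) = (INR a ^ k)%R.
Proof. by elim: k => // k IHk; rewrite expnS mult_INR IHk. Qed.

Lemma ln_form_bound f K m : (0 < K)%N -> (0 < m)%N ->
    (expn (3 * expn K 2) f <= expn 4 f * expn m 2)%N ->
  (INR f * (ln 3 + 2 * ln (INR K)) <= 2 * INR f * ln 2 + 2 * ln (INR m))%R.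
Proof.
move=> K_gt0 m_gt0 /ssrnat.leP/le_INR.
have pos k : (0 < k)%N -> (0 < INR k)%R by move=> /ssrnat.leP; apply: lt_0_INR.
have K_pos := pos _ K_gt0; have m_pos := pos _ m_gt0.
rewrite mult_INR !INR_expn mult_INR INR_expn.
have -> : INR 3 = 3%R by rewrite /=; Lra.lra.
have -> : INR 4 = 4%R by rewrite /=; Lra.lra.
have K2_pos := pow_lt _ 2 K_pos; have m2_pos := pow_lt _ 2 m_pos.
have base_pos : (0 < 3 * INR K ^ 2)%R by Lra.lra.
have four_pos : (0 < 4)%R by Lra.lra.
have four_pow := pow_lt _ f four_pos.
move/(ln_le (pow_lt _ _ base_pos)).
rewrite ln_mult // !ln_pow // ln_mult //; last Lra.lra.
rewrite ln_pow // (_ : 4 = 2 * 2)%R; last Lra.lra.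
rewrite ln_mult; [|Lra.lra..].
by rewrite (_ : INR 2 = 2%R) //; Lra.lra.
Qed.

Theorem theorem1p1 (m n : nat) (x y : int) :
  (0 < m)%N -> (3 <= n)%N -> (2 <= maxn `|x|%N `|y|%N)%N ->
  cycloBin n x y = Posz m ->
  (INR (totient n) <= 2 / ln 3 * ln (INR m))%R /\
  (INR (maxn `|x|%N `|y|%N) <= 2 / sqrt 3 * Rpower (INR m) (/ INR (totient n)))%R /\
  (m <> 1%N /\ m <> 2%N).
Proof.
move=> m_gt0 n_gt2 K_ge2 eq_m.
have := cycloBin_bound x y n_gt2; rewrite eq_m absz_nat.
move: (maxn _ _) K_ge2 => K K_ge2 {eq_m x y}.
have : (1 < totient n)%N by rewrite totient_gt1.
move: (totient n) => f {n n_gt2} f_gt1 bound.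
have m_gt2 := gt2_of_form_bound f_gt1 K_ge2 bound.
have le := ln_form_bound (ltnW K_ge2) m_gt0 bound.
have f_pos : (0 < INR f)%R by apply: lt_0_INR; apply/ssrnat.leP; apply: ltnW.
have K_ge2R : (2 <= INR K)%R by have := le_INR _ _ (elimT ssrnat.leP K_ge2).
have ln3_pos : (0 < ln 3)%R by rewrite -ln_1; apply: ln_increasing; Lra.lra.
split; [|split; last by split=> mE; rewrite mE in m_gt2].
  (* Since K >= 2, the term 2 f ln K absorbs 2 f ln 2, leaving f ln 3 <= 2 ln m. *)
  have lnK : (ln 2 <= ln (INR K))%R by apply: ln_le; Lra.lra.
  have ub : (INR f * ln 3 <= 2 * ln (INR m))%R.
    have := Rmult_le_compat_l _ _ _ (Rlt_le _ _ f_pos) lnK; Lra.lra.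
  apply: (Rmult_le_reg_r (ln 3)) => //.
  by rewrite (_ : 2 / ln 3 * ln (INR m) * ln 3 = 2 * ln (INR m))%R //; field; Lra.lra.
have sqrt3_pos : (0 < sqrt 3)%R by apply: sqrt_lt_R0; Lra.lra.
have ln_sqrt3 : (ln 3 = 2 * ln (sqrt 3))%R.
  rewrite -{1}(sqrt_sqrt 3); last Lra.lra.
  by rewrite ln_mult //; Lra.lra.
(* The logarithm of the second bound: [le] divided by 2f, with ln 3 = 2 ln(sqrt 3). *)
have main : (ln (INR K) <= ln 2 - ln (sqrt 3) + / INR f * ln (INR m))%R.
  apply: (Rmult_le_reg_l (INR f)) => //.
  have -> : (INR f * (ln 2 - ln (sqrt 3) + / INR f * ln (INR m))
             = INR f * ln 2 - INR f * ln (sqrt 3) + ln (INR m))%R.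
    by field; Lra.lra.
  by rewrite ln_sqrt3 in le; Lra.lra.
rewrite -[X in (X <= _)%R]exp_ln; last Lra.lra.
have -> : (2 / sqrt 3 = exp (ln 2 - ln (sqrt 3)))%R.
  by rewrite /Rminus exp_plus exp_Ropp !exp_ln //; Lra.lra.
rewrite /Rpower -exp_plus.
by case: main => [/exp_increasing/Rlt_le | ->] //; apply: Rle_refl.
Qed.
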